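(* Let $K$ be a field of characteristic $0$, let $d\geq 1$, and let $K[X_d,Y_d]=K[x_1,\ldots,x_d,y_1,\ldots,y_d]$ be the polynomial algebra in $2d$ variables over $K$. Let $\delta$ be the $K$-linear derivation of $K[X_d,Y_d]$ defined by $\delta(x_i)=0$ and $\delta(y_i)=x_i$ for $i=1,\ldots,d$. Then the algebra of constants $K[X_d,Y_d]^{\delta}$ is generated, as a $K$-algebra, by the elements $x_1,\ldots,x_d$ and the determinants \[ u_{ij}=\left\vert\begin{matrix}x_i&x_j\\ y_i&y_j\end{matrix}\right\vert=x_iy_j-x_jy_i,\quad 1\leq i<j\leq d. \]
   Context: A derivation of a $K$-algebra $A$ is a $K$-linear operator $\delta:A\to A$ satisfying the Leibniz rule $\delta(a_1a_2)=\delta(a_1)a_2+a_1\delta(a_2)$ for all $a_1,a_2\in A$. The algebra of constants of $\delta$ is its kernel $A^{\delta}=\{a\in A\mid \delta(a)=0\}$, which is a subalgebra of $A$. Algebras are unital and ''generated'' means generated as a unital $K$-algebra. *)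

(* Defs.v *)
From HB Require Import structures.
From mathcomp Require Import all_boot all_order all_algebra.
From mathcomp Require Import ring.
From mathcomp Require Export mpoly.

Set Implicit Arguments.
Unset Strict Implicit.
Unset Printing Implicit Defensive.

Import GRing.Theory.
Local Open Scope ring_scope.

Section Algebra.
Variables (K : fieldType) (A : algType K).

Definition is_derivation (delta : A -> A) : Prop :=
  linear delta /\
  forall a1 a2, delta (a1 * a2) = delta a1 * a2 + a1 * delta a2.

Definition constants (delta : A -> A) (a : A) : Prop := delta a = 0.

Definition is_subalgebra (B : A -> Prop) : Prop :=
  [/\ B 1,
      forall (c : K) a b, B a -> B b -> B (c *: a + b)
    & forall a b, B a -> B b -> B (a * b)].

Definition generated_subalgebra (S : A -> Prop) (a : A) : Prop :=
  forall B : A -> Prop,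
    is_subalgebra B -> (forall s, S s -> B s) -> B a.

Lemma generated_subalgebra_is_subalgebra (S : A -> Prop) :
  is_subalgebra (generated_subalgebra S).
Proof.
split=> [B [B1 _ _] _ //|c a b Sa Sb B algB SB|a b Sa Sb B algB SB].
  by case: (algB) => _ BL _; apply: BL; [exact: Sa | exact: Sb].
by case: (algB) => _ _ BM; apply: BM; [exact: Sa | exact: Sb].
Qed.

End Algebra.

(* The 2d variables of {mpoly K[d + d]} are split as (x_1, ..., x_d) followed
   by (y_1, ..., y_d), with indices starting at 0. *)
Section PolynomialAlgebra.
Variables (K : fieldType) (d : nat).
Local Notation KXY := {mpoly K[d + d]}.

Definition xvar (i : 'I_d) : KXY := 'X_(lshift d i).
Definition yvar (i : 'I_d) : KXY := 'X_(rshift d i).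

Definition udet (i j : 'I_d) : KXY :=
  \det (\matrix_(r < 2, c < 2)
    (if r == 0 then xvar else yvar) (if c == 0 then i else j)).

Lemma udetE i j : udet i j = xvar i * yvar j - xvar j * yvar i.
Proof.
rewrite /udet (expand_det_row _ ord0) !big_ord_recl big_ord0 /cofactor.
by rewrite !det_mx11 !mxE /= /bump /= !expr0 expr1; ring.
Qed.

Definition xu_generators (p : KXY) : Prop :=
  (exists i : 'I_d, p = xvar i) \/
  (exists i j : 'I_d, (i < j)%N /\ p = udet i j).

(* This and derivation_xy_unique justify introducing the derivation through
   its values on the variables. *)
Lemma exists_derivation_xy :
  exists delta : KXY -> KXY,
    [/\ is_derivation delta,
        forall i, delta (xvar i) = 0
      & forall i, delta (yvar i) = xvar i].
Proof.
exists (fun p => \sum_(i < d) xvar i * p^`M(rshift d i)).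
split=> [|i|i].
- split=> [c p q|p q].
    rewrite scaler_sumr -big_split /=; apply: eq_bigr => i _.
    by rewrite mderivD mderivZ mulrDr scalerAr.
  rewrite mulr_suml mulr_sumr -big_split /=; apply: eq_bigr => i _.
  by rewrite mderivM; ring.
- rewrite big1 // => j _; rewrite mderivX mnm1E eq_lrshift.
  by rewrite scale0r mulr0.
rewrite (bigD1 i) //= big1 => [|j ji]; rewrite mderivX mnm1E eq_rshift.
  by rewrite eqxx scale1r -[X in (X - _)%MM]add0m addmK mpolyX0 mulr1 addr0.
by rewrite eq_sym (negPf ji) scale0r mulr0.
Qed.

Lemma derivation_xy_unique (delta1 delta2 : KXY -> KXY) :
  is_derivation delta1 -> is_derivation delta2 ->
  (forall i, delta1 (xvar i) = delta2 (xvar i)) ->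
  (forall i, delta1 (yvar i) = delta2 (yvar i)) ->
  delta1 =1 delta2.
Proof.
move=> [lin1 leib1] [lin2 leib2] eqx eqy.
have d0 (D : KXY -> KXY) : linear D -> D 0 = 0.
  by move=> lin; have := lin (-1) 0 0; rewrite scaler0 addr0 scaleN1r addNr.
have d1 (D : KXY -> KXY) :
  (forall a b, D (a * b) = D a * b + a * D b) -> D 1 = 0.
  move=> leib; have /eqP := leib 1 1.
  by rewrite !mulr1 mul1r eq_sym -subr_eq0 addrK => /eqP.
have eqX (k : 'I_(d + d)) : delta1 'X_k = delta2 'X_k.
  by case: (split_ordP k) => i ->; [exact: eqx | exact: eqy].
have eqXn (k : 'I_(d + d)) n : delta1 ('X_k ^+ n) = delta2 ('X_k ^+ n).
  elim: n => [|n IHn]; first by rewrite !expr0 !d1.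
  by rewrite !exprS leib1 leib2 eqX IHn.
have eqXm m : delta1 'X_[m] = delta2 'X_[m].
  rewrite mpolyXE_id.
  apply: (big_ind (fun p => delta1 p = delta2 p)) => [|p q ep eq|k _].
  - by rewrite !d1.
  - by rewrite leib1 leib2 ep eq.
  - exact: eqXn.
elim/mpolyind=> [|c m p _ _ IHp]; first by rewrite !d0.
by rewrite lin1 lin2 eqXm IHp.
Qed.

End PolynomialAlgebra.

Arguments xvar {K d} i.
Arguments yvar {K d} i.
Arguments udet {K d} i j.

(* Main.v *)
Require Import Defs.
From HB Require Import structures.
From mathcomp Require Import all_boot all_order all_algebra.
From mathcomp Require Import mpoly.
From mathcomp Require Import zify ring.

Set Implicit Arguments.
Unset Strict Implicit.
Unset Printing Implicit Defensive.

Import GRing.Theory.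
Local Open Scope ring_scope.

(** The derivation is [E], the sum of the [x_i d/dy_i].  Together with [F], the
    sum of the [y_i d/dx_i], and [H = EF - FE], which multiplies a monomial by
    its degree in the [x_i] minus its degree in the [y_i] (its weight), it
    makes the polynomial ring a representation of the Lie algebra sl2.

    The constants are reached by induction on the number [k] of pairs
    [(x_i, y_i)] that occur, for constants [f] of weight [n]; the claim is that
    [f] is a combination of products of the [u_ij] with exactly [n] of the
    [x_i] ([xu_span]).  Order the monomials in the last pair [(x, y)] by the
    exponent of [y] first and that of [x] next, and let [g x^a y^b] be the
    leading part of [f].  Applying [E] to [f] shows that [g] is a constant in
    fewer pairs, of weight [n - a + b].  The essential point is the bound
    [a <= n] ([leading_x_degree_le]): by [E f = 0], applying [E^b] to the
    derivative [h] of order [a + b] of [f] in [x] gives a nonzero multiple of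
    [g], while [E^(b+1) h = 0]; and in a locally finite sl2-representation
    [E^(b+1)] is injective on vectors of weight at most [-(b+1)]
    ([raising_inj_neg_weight]), so the weight [n - a - b] of [h] is at least
    [-b].

    By induction [g] is a combination of products with [n - a + b >= b] factors
    [x_i].  Turning [b] of these factors [x_i] into the determinants
    [x_i y - x y_i], whose leading part is [x_i y], and multiplying by [x^a]
    gives an element of the algebra with leading part [g x^a y^b]
    ([xu_span_lift]).  Subtracting it lowers the leading part, and this
    terminates ([xu_span_step]).

    Leading coefficients are handled as iterated partial derivatives: no
    expansion of a polynomial in [x] and [y] is needed, since [g] is, up to
    a factorial factor, [d^a/dx^a d^b/dy^b f], and all the operators involved
    have simple commutators.  A general constant is reduced to constants having
    a weight by Lagrange interpolation in [H] ([constants_generated]). *)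

(** * Derivations of an algebra *)

Section DerivationAlgebra.
Variables (K : fieldType) (A : algType K).
Implicit Types (D : A -> A) (a b : A).

Lemma derivationD D a b : is_derivation D -> D (a + b) = D a + D b.
Proof. by case=> lin _; have := lin 1 a b; rewrite !scale1r. Qed.

Lemma derivation0 D : is_derivation D -> D 0 = 0.
Proof.
by case=> lin _; have := lin (-1) 0 0; rewrite scaler0 addr0 scaleN1r addNr.
Qed.

Lemma derivationZ D c a : is_derivation D -> D (c *: a) = c *: D a.
Proof.
by move=> dD; case: (dD) => lin _; have := lin c a 0;
  rewrite (derivation0 dD) !addr0.
Qed.

Lemma derivationB D a b : is_derivation D -> D (a - b) = D a - D b.
Proof. by move=> dD; rewrite -!scaleN1r (derivationD _ _ dD) derivationZ. Qed.

Lemma derivationN D a : is_derivation D -> D (- a) = - D a.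
Proof. by move=> dD; rewrite -!scaleN1r derivationZ. Qed.

Lemma derivationM D a b : is_derivation D -> D (a * b) = D a * b + a * D b.
Proof. by case. Qed.

Lemma derivation1 D : is_derivation D -> D 1 = 0.
Proof.
move=> dD; have /eqP := derivationM 1 1 dD.
by rewrite !mulr1 mul1r eq_sym -subr_eq0 addrK => /eqP.
Qed.

Lemma derivationX_eq0 D n a : is_derivation D -> D a = 0 -> D (a ^+ n) = 0.
Proof.
move=> dD Da; elim: n => [|n IHn]; first exact: derivation1.
by rewrite exprS (derivationM _ _ dD) Da IHn mul0r mulr0 addr0.
Qed.

Lemma iter_derivation0 D n : is_derivation D -> iter n D 0 = 0.
Proof. by move=> dD; elim: n => //= n ->; exact: derivation0. Qed.

Lemma iter_derivationD D n a b :
  is_derivation D -> iter n D (a + b) = iter n D a + iter n D b.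
Proof. by move=> dD; elim: n => //= n ->; exact: derivationD. Qed.

Lemma iter_derivationZ D n c a :
  is_derivation D -> iter n D (c *: a) = c *: iter n D a.
Proof. by move=> dD; elim: n => //= n ->; exact: derivationZ. Qed.

Lemma iter_derivationB D n a b :
  is_derivation D -> iter n D (a - b) = iter n D a - iter n D b.
Proof. by move=> dD; elim: n => //= n ->; exact: derivationB. Qed.

Lemma iter_derivation_const D n a b : is_derivation D -> D a = 0 ->
  iter n D (a * b) = a * iter n D b.
Proof.
move=> dD Da; elim: n => //= n ->.
by rewrite (derivationM _ _ dD) Da mul0r add0r.
Qed.

Lemma iter_eq0_leq D m n a : is_derivation D -> (m <= n)%N ->
  iter m D a = 0 -> iter n D a = 0.
Proof.
by move=> dD /subnK <- Dm; rewrite iterD Dm; exact: iter_derivation0.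
Qed.

(** The Leibniz rule applied once leaves two products, each with one of its
    factors closer to being killed; hence nilpotency indices add. *)
Lemma iter_derivationM_eq0 D m n a b : is_derivation D ->
  iter m D a = 0 -> iter n D b = 0 -> iter (m + n) D (a * b) = 0.
Proof.
move=> dD; have [s] := ubnP (m + n)%N; elim: s m n a b => // s IHs m n a b.
case: m => [|m] les.
  by move=> /= -> _; rewrite mul0r; exact: iter_derivation0.
case: n les => [|n] les.
  by move=> _ /= ->; rewrite mulr0; exact: (iter_derivation0 _.+1).
move=> Da Db; rewrite addSn iterSr (derivationM _ _ dD) iter_derivationD //.
rewrite IHs ?add0r; first 1 last.
- by move: les; lia.
- by rewrite -iterSr.
- by [].
by rewrite addnS -addSn IHs // -?iterSr //; move: les; lia.
Qed.

Lemma commutator_is_derivation D1 D2 :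
  is_derivation D1 -> is_derivation D2 ->
  is_derivation (fun a => D1 (D2 a) - D2 (D1 a)).
Proof.
move=> d1 d2; split=> [c a b|a b].
  rewrite !(derivationD _ _ d1, derivationD _ _ d2, derivationZ _ _ d1,
            derivationZ _ _ d2) scalerBr opprD.
  by rewrite -!addrA; congr (_ + _); rewrite addrCA.
rewrite !(derivationD _ _ d1, derivationD _ _ d2, derivationM _ _ d1,
          derivationM _ _ d2).
rewrite mulrBl mulrBr [X in X - _](AC (2*2) (1*4*(2*3))).
rewrite [X in _ - X](AC (2*2) (1*4*(3*2))) opprD addrACA subrr addr0.
by rewrite opprD addrACA.
Qed.

Lemma scale_is_derivation D c :
  is_derivation D -> is_derivation (fun a => c *: D a).
Proof.
move=> dD; split=> [e a b|a b].
  by rewrite (derivationD _ _ dD) (derivationZ _ _ dD) scalerDr !scalerA mulrC.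
by rewrite (derivationM _ _ dD) scalerDr scalerAl scalerAr.
Qed.

End DerivationAlgebra.

(** * The sl2-triple on the polynomial ring *)

Section Nowicki.
Variables (K : fieldType) (d : nat).
Local Notation KXY := {mpoly K[d + d]}.
Implicit Types (f g h : KXY) (i j : 'I_d).

Definition dx i f : KXY := f^`M(lshift d i).
Definition dy i f : KXY := f^`M(rshift d i).

Lemma mderiv_is_derivation (k : 'I_(d + d)) :
  is_derivation (fun f : KXY => f^`M(k)).
Proof.
by split=> [c f g|f g]; rewrite ?mderivM // mderivD mderivZ.
Qed.

Lemma dx_der i : is_derivation (dx i).
Proof. exact: mderiv_is_derivation. Qed.

Lemma dy_der i : is_derivation (dy i).
Proof. exact: mderiv_is_derivation. Qed.

Lemma mderiv_var (k l : 'I_(d + d)) : ('X_l : KXY)^`M(k) = (l == k)%:R.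
Proof.
rewrite mderivX mnm1E; case: eqVneq => [->|_]; last by rewrite scale0r.
by rewrite scale1r -[X in (X - _)%MM]add0m addmK mpolyX0.
Qed.

Lemma dx_x i j : dx i (xvar j) = (j == i)%:R.
Proof. by rewrite /dx mderiv_var eq_lshift. Qed.

Lemma dx_y i j : dx i (yvar j) = 0.
Proof. by rewrite /dx mderiv_var eq_rlshift. Qed.

Lemma dy_x i j : dy i (xvar j) = 0.
Proof. by rewrite /dy mderiv_var eq_lrshift. Qed.

Lemma dy_y i j : dy i (yvar j) = (j == i)%:R.
Proof. by rewrite /dy mderiv_var eq_rshift. Qed.

(** All three operators of the sl2-triple, and hence all the commutators needed,
    are derivations, so identities between them are checked on variables. *)
Definition vector_field (v w : 'I_d -> KXY) f : KXY :=
  \sum_i (v i * dx i f + w i * dy i f).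

Lemma vector_field_der v w : is_derivation (vector_field v w).
Proof.
split=> [c f g|f g]; rewrite /vector_field.
  rewrite scaler_sumr -big_split /=; apply: eq_bigr => i _.
  by rewrite /dx /dy !mderivD !mderivZ !mulrDr -!scalerAr scalerDr addrACA.
rewrite mulr_suml mulr_sumr -big_split /=; apply: eq_bigr => i _.
rewrite /dx /dy !mderivM; ring.
Qed.

Lemma vector_field_x v w i : vector_field v w (xvar i) = v i.
Proof.
rewrite /vector_field (bigD1 i) //= big1 => [|j /negPf ji].
  by rewrite dx_x dy_x eqxx /=; ring.
by rewrite dx_x dy_x eq_sym ji /=; ring.
Qed.

Lemma vector_field_y v w i : vector_field v w (yvar i) = w i.
Proof.
rewrite /vector_field (bigD1 i) //= big1 => [|j /negPf ji].
  by rewrite dx_y dy_y eqxx /=; ring.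
by rewrite dx_y dy_y eq_sym ji /=; ring.
Qed.

Definition raising : KXY -> KXY := vector_field (fun=> 0) xvar.
Definition lowering : KXY -> KXY := vector_field yvar (fun=> 0).
Definition weight_op : KXY -> KXY := vector_field xvar (fun i => - yvar i).
Local Notation E := raising.
Local Notation F := lowering.
Local Notation H := weight_op.

Lemma E_der : is_derivation E. Proof. exact: vector_field_der. Qed.
Lemma F_der : is_derivation F. Proof. exact: vector_field_der. Qed.
Lemma H_der : is_derivation H. Proof. exact: vector_field_der. Qed.
Lemma E_x i : E (xvar i) = 0. Proof. exact: vector_field_x. Qed.
Lemma E_y i : E (yvar i) = xvar i. Proof. exact: vector_field_y. Qed.
Lemma F_x i : F (xvar i) = yvar i. Proof. exact: vector_field_x. Qed.
Lemma F_y i : F (yvar i) = 0. Proof. exact: vector_field_y. Qed.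
Lemma H_x i : H (xvar i) = xvar i. Proof. exact: vector_field_x. Qed.
Lemma H_y i : H (yvar i) = - yvar i. Proof. exact: vector_field_y. Qed.

Lemma commutator_eq (D1 D2 D3 : KXY -> KXY) c :
  is_derivation D1 -> is_derivation D2 -> is_derivation D3 ->
  (forall i, D1 (D2 (xvar i)) - D2 (D1 (xvar i)) = c *: D3 (xvar i)) ->
  (forall i, D1 (D2 (yvar i)) - D2 (D1 (yvar i)) = c *: D3 (yvar i)) ->
  forall f, D1 (D2 f) = D2 (D1 f) + c *: D3 f.
Proof.
move=> d1 d2 d3 eqx eqy f; apply/eqP; rewrite addrC -subr_eq; apply/eqP.
exact: (derivation_xy_unique (commutator_is_derivation d1 d2)
          (scale_is_derivation c d3) eqx eqy).
Qed.

Lemma EF_comm f : E (F f) = F (E f) + H f.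
Proof.
rewrite -[H f]scale1r; apply: (commutator_eq E_der F_der H_der) => i.
  by rewrite F_x E_x E_y (derivation0 F_der) H_x scale1r subr0.
by rewrite F_y E_y F_x (derivation0 E_der) H_y scale1r sub0r.
Qed.

Lemma HE_comm f : H (E f) = E (H f) + 2%:R *: E f.
Proof.
apply: (commutator_eq H_der E_der E_der) => i.
  by rewrite H_x E_x (derivation0 H_der) scaler0 subr0.
by rewrite H_y E_y H_x (derivationN _ E_der) E_y opprK scaler_nat.
Qed.

Lemma HF_comm f : H (F f) = F (H f) + (- 2%:R) *: F f.
Proof.
apply: (commutator_eq H_der F_der F_der) => i.
  by rewrite H_x F_x H_y scaleNr scaler_nat mulr2n opprD.
rewrite H_y F_y (derivationN _ F_der) F_y (derivation0 H_der).
by rewrite scaler0 oppr0 subr0.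
Qed.

Lemma Hdx_comm k f : H (dx k f) = dx k (H f) + (-1) *: dx k f.
Proof.
apply: (commutator_eq H_der (dx_der k) (dx_der k)) => i.
  rewrite H_x dx_x scaleN1r; case: (_ == _).
    by rewrite (derivation1 H_der) sub0r.
  by rewrite (derivation0 H_der) sub0r.
rewrite H_y (derivationN _ (dx_der k)) dx_y (derivation0 H_der).
by rewrite scaler0 oppr0 subr0.
Qed.

Lemma Hdy_comm k f : H (dy k f) = dy k (H f) + 1 *: dy k f.
Proof.
apply: (commutator_eq H_der (dy_der k) (dy_der k)) => i.
  by rewrite H_x dy_x (derivation0 H_der) scaler0 subr0.
rewrite H_y (derivationN _ (dy_der k)) dy_y opprK.
rewrite scale1r; case: (_ == _).
  by rewrite (derivation1 H_der) add0r.
by rewrite (derivation0 H_der) add0r.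
Qed.

Lemma Edx_comm k f : E (dx k f) = dx k (E f) + (-1) *: dy k f.
Proof.
apply: (commutator_eq E_der (dx_der k) (dy_der k)) => i.
  rewrite E_x dx_x dy_x (derivation0 (dx_der k)) scaler0 subr0.
  by case: (_ == _); rewrite ?(derivation1 E_der) ?(derivation0 E_der).
by rewrite E_y dx_y dx_x dy_y (derivation0 E_der) scaleN1r sub0r.
Qed.

Lemma Edy_comm k f : E (dy k f) = dy k (E f).
Proof.
rewrite -[RHS]addr0 -[X in _ + X](scale0r (dy k f)).
apply: (commutator_eq E_der (dy_der k) (dy_der k)) => i.
  rewrite E_x dy_x (derivation0 E_der) (derivation0 (dy_der k)).
  by rewrite subr0 scale0r.
rewrite E_y dy_x dy_y subr0 scale0r.
by case: (_ == _); rewrite ?(derivation1 E_der) ?(derivation0 E_der).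
Qed.

(** * Local nilpotence *)

Lemma subalgebra_full (B : KXY -> Prop) : is_subalgebra B ->
  (forall i, B (xvar i)) -> (forall i, B (yvar i)) -> forall f, B f.
Proof.
case=> B1 BL BM Bx By.
have B0 : B 0 by have := BL (-1) 1 1 B1 B1; rewrite scaleN1r addNr.
have BX (k : 'I_(d + d)) : B 'X_k.
  by case: (split_ordP k) => i ->; [exact: Bx | exact: By].
elim/mpolyind=> [//|c m p _ _ Bp]; apply: BL => //.
rewrite mpolyXE_id; apply: (big_ind B) => // k _.
by elim: (m k) => [|n IHn]; rewrite ?expr0 // exprS; apply: BM.
Qed.

(** Leibniz makes the elements killed by a power of [D] a subalgebra, so it is
    enough that the variables are among them. *)
Lemma locally_nilpotent (D : KXY -> KXY) : is_derivation D ->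
  (forall i, D (D (xvar i)) = 0) -> (forall i, D (D (yvar i)) = 0) ->
  forall f, exists n, iter n D f = 0.
Proof.
move=> dD D2x D2y; apply: subalgebra_full => [|i|i]; last 2 first.
- by exists 2%N; exact: D2x.
- by exists 2%N; exact: D2y.
split=> [|c f g [m Df] [n Dg]|f g [m Df] [n Dg]].
- by exists 1%N; exact: derivation1.
- exists (m + n)%N; rewrite iter_derivationD // iter_derivationZ //.
  rewrite (iter_eq0_leq dD _ Df) ?leq_addr //.
  by rewrite (iter_eq0_leq dD _ Dg) ?leq_addl // scaler0 addr0.
by exists (m + n)%N; exact: iter_derivationM_eq0.
Qed.

Lemma F_nilpotent f : exists n, iter n F f = 0.
Proof.
apply: (locally_nilpotent F_der) => i.
  by rewrite F_x F_y.
by rewrite F_y (derivation0 F_der).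
Qed.

Lemma dx_nilpotent i f : exists n, iter n (dx i) f = 0.
Proof.
apply: (locally_nilpotent (dx_der i)) => j; last first.
  by rewrite dx_y (derivation0 (dx_der i)).
rewrite dx_x; case: (_ == _); first exact: derivation1 (dx_der i).
exact: derivation0 (dx_der i).
Qed.

Lemma dy_nilpotent i f : exists n, iter n (dy i) f = 0.
Proof.
apply: (locally_nilpotent (dy_der i)) => j.
  by rewrite dy_x (derivation0 (dy_der i)).
rewrite dy_y; case: (_ == _); first exact: derivation1 (dy_der i).
exact: derivation0 (dy_der i).
Qed.

(** * Weights *)

Definition has_weight (w : int) f := H f = w%:~R *: f.

Lemma has_weightB w f g :
  has_weight w f -> has_weight w g -> has_weight w (f - g).
Proof.
by rewrite /has_weight => Hf Hg; rewrite (derivationB _ _ H_der) Hf Hg scalerBr.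
Qed.

Lemma has_weightD w f g :
  has_weight w f -> has_weight w g -> has_weight w (f + g).
Proof.
by rewrite /has_weight => Hf Hg; rewrite (derivationD _ _ H_der) Hf Hg scalerDr.
Qed.

Lemma has_weightZ w c f : has_weight w f -> has_weight w (c *: f).
Proof.
by rewrite /has_weight => Hf; rewrite (derivationZ _ _ H_der) Hf !scalerA mulrC.
Qed.

Lemma has_weightM v w f g :
  has_weight v f -> has_weight w g -> has_weight (v + w) (f * g).
Proof.
rewrite /has_weight => Hf Hg; rewrite (derivationM _ _ H_der) Hf Hg.
by rewrite rmorphD /= scalerDl scalerAl scalerAr.
Qed.

Lemma has_weight1 : has_weight 0 1.
Proof. by rewrite /has_weight (derivation1 H_der) scale0r. Qed.

Lemma has_weight_x i : has_weight 1 (xvar i).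
Proof. by rewrite /has_weight H_x scale1r. Qed.

Lemma has_weight_y i : has_weight (-1) (yvar i).
Proof. by rewrite /has_weight H_y scaleN1r. Qed.

Lemma has_weight_F w f : has_weight w f -> has_weight (w - 2) (F f).
Proof.
rewrite /has_weight => Hf.
by rewrite HF_comm Hf (derivationZ _ _ F_der) -scalerDl rmorphB.
Qed.

Lemma has_weight_dx i n w f :
  has_weight w f -> has_weight (w - n%:Z) (iter n (dx i) f).
Proof.
move=> Hf; elim: n => [|n IHn]; first by rewrite subr0.
move: IHn; rewrite /has_weight /= => IHn.
rewrite Hdx_comm IHn (derivationZ _ _ (dx_der i)) -scalerDl.
rewrite -(rmorphD (intr : int -> K) _ (-1)%R).
by congr (_%:~R *: _); lia.
Qed.

Lemma has_weight_dy i n w f :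
  has_weight w f -> has_weight (w + n%:Z) (iter n (dy i) f).
Proof.
move=> Hf; elim: n => [|n IHn]; first by rewrite addr0.
move: IHn; rewrite /has_weight /= => IHn.
rewrite Hdy_comm IHn (derivationZ _ _ (dy_der i)) -scalerDl.
rewrite -(rmorphD (intr : int -> K) _ 1%R).
by congr (_%:~R *: _); lia.
Qed.

(** The classical commutation rule [E^(n+1) F = F E^(n+1) + (n+1)(w+n) E^n] on
    a vector of weight [w]: the last term collects the [n + 1] commutators
    [EF - FE = H], evaluated at weights [w], [w + 2], ..., [w + 2n]. *)
Lemma iterE_F n w f : has_weight w f ->
  iter n.+1 E (F f) =
    F (iter n.+1 E f) + (n.+1%:Z * (w + n%:Z))%:~R *: iter n E f.
Proof.
move=> Hf; have HEn m : H (iter m E f) = (w + 2 * m%:Z)%:~R *: iter m E f.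
  elim: m => [|m IHm]; first by rewrite mulr0 addr0.
  rewrite iterS HE_comm IHm (derivationZ _ _ E_der) -scalerDl.
  rewrite -(rmorphD (intr : int -> K) _ 2%R).
  by congr (_%:~R *: _); lia.
elim: n => [|n IHn]; first by rewrite /= EF_comm mul1r addr0 Hf.
rewrite iterS IHn (derivationD _ _ E_der) EF_comm (derivationZ _ _ E_der).
rewrite -!iterS HEn -addrA -scalerDl -rmorphD /=.
by congr (_ + _%:~R *: _); lia.
Qed.

Hypothesis K_char0 : [pchar K] =i pred0.

Lemma natrK_eq0 n : (n%:R == 0 :> K) = (n == 0%N).
Proof. by move/pcharf0P: K_char0. Qed.

Lemma intrK_eq0 (z : int) : (z%:~R == 0 :> K) = (z == 0).
Proof.
case: z => n; first exact: natrK_eq0.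
by rewrite NegzE rmorphN /= oppr_eq0 natrK_eq0.
Qed.

(** In terms of irreducible representations: a vector of weight [w < 0] can be
    raised at least to weight [-w], which takes [-w] steps.  The proof lowers
    [h] instead.  If [E^m h = 0], then [F h] satisfies the hypotheses with
    [m + 1] and [w - 2], so [F h = 0] by induction on the nilpotency index of
    [F]; then the commutation rule makes [E^(m-1) h] a multiple of zero by a
    nonzero integer, and one descends to [E^0 h]. *)
Lemma raising_inj_neg_weight m w h :
  has_weight w h -> (m%:Z <= - w)%R -> iter m E h = 0 -> h = 0.
Proof.
have [n] := F_nilpotent h.
elim: n m w h => [|n IHn] m w h //; rewrite iterSr => Fh Hh lemw Emh.
have Fh0 : F h = 0.
  apply: (IHn m.+1 _ _ Fh (has_weight_F Hh)); first by lia.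
  by rewrite (iterE_F _ Hh) Emh scaler0 /= Emh (derivation0 E_der)
             (derivation0 F_der) addr0.
elim: m lemw Emh => [//|m IHm] lemw Emh; apply: IHm; first by lia.
have /esym/eqP := iterE_F m Hh.
rewrite Fh0 Emh (derivation0 F_der) (iter_derivation0 _ E_der) add0r.
rewrite scaler_eq0 intrK_eq0 mulf_eq0 => /orP[|/eqP //].
by move: lemw; lia.
Qed.

(** * Leading coefficients as iterated derivatives *)

Lemma E_iter_dy i n f : E f = 0 -> E (iter n (dy i) f) = 0.
Proof.
move=> Ef; elim: n => //= n IHn.
by rewrite Edy_comm IHn (derivation0 (dy_der i)).
Qed.

Lemma iter_dx_dy i m n f :
  iter m (dx i) (iter n (dy i) f) = iter n (dy i) (iter m (dx i) f).
Proof.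
have C g : dx i (iter n (dy i) g) = iter n (dy i) (dx i g).
  elim: n g => // n IHn g; rewrite !iterSr IHn; congr (iter _ _ _).
  exact: mderiv_comm.
by elim: m => //= m ->.
Qed.

Lemma E_iter_dx i n f : E f = 0 ->
  E (iter n.+1 (dx i) f) = (- n.+1%:R) *: iter n (dx i) (dy i f).
Proof.
move=> Ef; elim: n => [|n IHn].
  by rewrite /= Edx_comm Ef (derivation0 (dx_der i)) add0r.
rewrite iterS Edx_comm IHn (derivationZ _ _ (dx_der i)) -iterS.
rewrite -[dy i (iter _ _ _)]/(iter 1 (dy i) _) -iter_dx_dy /= -scalerDl.
by congr (_ *: _); rewrite -[n.+2%:R]natr1 opprD.
Qed.

(** Each [E] exchanges one [d/dx] for one [d/dy], since their commutator is
    [- d/dy] and [f] is a constant; [d/dy] itself commutes with [E].  This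
    exhibits the leading coefficient of a constant as an element of the image
    of a power of [E]. *)
Lemma iterE_iter_dx i (j n : nat) f : E f = 0 ->
  exists2 c : K, c != 0 &
    iter j E (iter (n + j) (dx i) f) = c *: iter n (dx i) (iter j (dy i) f).
Proof.
elim: j f => [|j IHj] f Ef.
  by exists 1; [exact: oner_neq0 | rewrite addn0 scale1r].
have [c c0 cP] := IHj (dy i f) (E_iter_dy i 1 Ef).
exists (- (n + j).+1%:R * c); first by rewrite mulf_neq0 // oppr_eq0 natrK_eq0.
rewrite iterSr addnS E_iter_dx // (iter_derivationZ _ _ _ E_der) cP.
by rewrite scalerA iterSr.
Qed.

(** * Products of the generators, counted by weight *)

(** In characteristic [0] these are the polynomials in the first [k] pairs of
    variables; stated with derivatives, the property passes to the iterated
    derivatives of a polynomial because partial derivatives commute. *)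
Definition in_first (k : nat) f :=
  forall i, (k <= i)%N -> dx i f = 0 /\ dy i f = 0.

(** The part of weight [n] of the algebra generated by the [x_i] and [u_ij] with
    indices below [k].  Each product carries exactly [n] factors [x_i], because
    the [u_ij] have weight [0]; recording this count is what allows [x_i] to be
    traded for determinants in [xu_span_lift]. *)
Inductive xu_span (k : nat) : nat -> KXY -> Prop :=
| Xu0 n : xu_span k n 0
| Xu1 : xu_span k 0 1
| XuL n c f g : xu_span k n f -> xu_span k n g -> xu_span k n (c *: f + g)
| XuX n i f : (i < k)%N -> xu_span k n f -> xu_span k n.+1 (xvar i * f)
| XuU n i j f : (i < j)%N -> (j < k)%N -> xu_span k n f ->
    xu_span k n (udet i j * f).

Lemma xu_spanS k n f : xu_span k n f -> xu_span k.+1 n f.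
Proof.
elim=> {n f}.
- exact: Xu0.
- exact: Xu1.
- by move=> *; exact: XuL.
- by move=> n i f ik _ IH; apply: XuX IH; exact: ltnW.
- by move=> n i j f ij jk _ IH; apply: XuU IH => //; exact: ltnW.
Qed.

Lemma xu_span_exp k n i m f : (i < k)%N -> xu_span k n f ->
  xu_span k (n + m) (xvar i ^+ m * f).
Proof.
move=> ik Gf; elim: m => [|m IHm]; first by rewrite addn0 mul1r.
by rewrite addnS exprS -mulrA; exact: XuX.
Qed.

Lemma E_udet i j : E (udet i j) = 0.
Proof.
rewrite udetE (derivationB _ _ E_der) !(derivationM _ _ E_der) !E_x !E_y; ring.
Qed.

Lemma has_weight_udet i j : has_weight 0 (udet i j).
Proof.
by rewrite udetE; apply: has_weightB;
  apply: (has_weightM (has_weight_x _) (has_weight_y _)).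
Qed.

Lemma dx_udet i j k : k != i -> k != j -> dx k (udet i j) = 0.
Proof.
move=> /negPf ki /negPf kj; have D := dx_der k.
rewrite udetE (derivationB _ _ D) !(derivationM _ _ D) !dx_x !dx_y.
by rewrite (eq_sym i) (eq_sym j) ki kj /=; ring.
Qed.

Lemma dy_udet_last i k : i != k -> dy k (udet i k) = xvar i.
Proof.
move=> /negPf ik; have D := dy_der k.
rewrite udetE (derivationB _ _ D) !(derivationM _ _ D) !dy_x !dy_y.
by rewrite ik eqxx /=; ring.
Qed.

Lemma dy_udet i j k : k != i -> k != j -> dy k (udet i j) = 0.
Proof.
move=> /negPf ki /negPf kj; have D := dy_der k.
rewrite udetE (derivationB _ _ D) !(derivationM _ _ D) !dy_x !dy_y.
by rewrite (eq_sym i) (eq_sym j) ki kj /=; ring.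
Qed.

Lemma xu_span_E k n f : xu_span k n f -> E f = 0.
Proof.
elim=> {n f}.
- by move=> _; exact: derivation0 E_der.
- exact: derivation1 E_der.
- move=> n c f g _ IHf _ IHg.
  rewrite (derivationD _ _ E_der) (derivationZ _ _ E_der) IHf IHg.
  by rewrite scaler0 addr0.
- move=> n i f _ _ IHf.
  by rewrite (derivationM _ _ E_der) IHf E_x mul0r mulr0 addr0.
- move=> n i j f _ _ _ IHf.
  by rewrite (derivationM _ _ E_der) IHf E_udet mul0r mulr0 addr0.
Qed.

Lemma xu_span_weight k n f : xu_span k n f -> has_weight n f.
Proof.
elim=> {n f}.
- by move=> n; rewrite /has_weight (derivation0 H_der) scaler0.
- exact: has_weight1.
- by move=> n c f g _ IHf _ IHg; apply/has_weightD/IHg/has_weightZ.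
- by move=> n i f _ _ IHf; rewrite -add1n PoszD;
    apply: has_weightM (has_weight_x i) _.
- move=> n i j f _ _ _ IHf; rewrite -[n%:Z]add0r.
  exact: has_weightM (has_weight_udet i j) _.
Qed.

Lemma ord_gt_neq i j : (i < j)%N -> j != i.
Proof. by move=> ij; apply: contraTneq ij => ->; rewrite ltnn. Qed.

Lemma xu_span_in_first k n f : xu_span k n f -> in_first k f.
Proof.
move=> Gf i ki; have [Dx Dy] := (dx_der i, dy_der i).
elim: Gf => {n f}.
- by move=> n; rewrite (derivation0 Dx) (derivation0 Dy).
- by rewrite (derivation1 Dx) (derivation1 Dy).
- move=> n c f g _ [fx fy] _ [gx gy].
  rewrite (derivationD _ _ Dx) (derivationZ _ _ Dx) fx gx.
  by rewrite (derivationD _ _ Dy) (derivationZ _ _ Dy) fy gy scaler0 addr0.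
- move=> n j f jk _ [fx fy].
  rewrite (derivationM _ _ Dx) (derivationM _ _ Dy) fx fy dx_x dy_x.
  have /ord_gt_neq : (j < i)%N by exact: leq_trans ki.
  by rewrite eq_sym => /negPf ->; rewrite mul0r mulr0 addr0.
- move=> n j l f jl lk _ [fx fy].
  have li : (l < i)%N by exact: leq_trans ki.
  have il := ord_gt_neq li; have ij := ord_gt_neq (ltn_trans jl li).
  rewrite (derivationM _ _ Dx) (derivationM _ _ Dy) fx fy.
  by rewrite dx_udet // dy_udet // mul0r mulr0 addr0.
Qed.

(** The determinant has degree one in the variable [y_k], so only two terms of
    the Leibniz formula survive. *)
Lemma iter_dy_udetM i k n f : i != k ->
  iter n.+1 (dy k) (udet i k * f) =
    udet i k * iter n.+1 (dy k) f + n.+1%:R *: (xvar i * iter n (dy k) f).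
Proof.
move=> ik; have D := dy_der k; elim: n => [|n IHn].
  by rewrite /= (derivationM _ _ D) dy_udet_last // scale1r addrC.
rewrite iterS IHn (derivationD _ _ D) (derivationZ _ _ D) !(derivationM _ _ D).
rewrite dy_udet_last // dy_x mul0r add0r -!iterS !scaler_nat.
by rewrite -[n.+2]addn1 mulrnDr mulr1n; ring.
Qed.

(** Replacing [b] of the factors [x_i] in each product by [u_ik], whose
    coefficient of [y_k] is [x_i], gives a polynomial with top coefficient [g]
    in degree [b] of [y_k]; the [b]-th derivative contributes the factorial. *)
Lemma xu_span_lift (k : 'I_d) n b g : xu_span k (n + b) g ->
  exists2 f, xu_span k.+1 n f & iter b (dy k) f = b`!%:R *: g.
Proof.
move eqm: (n + b)%N => m Gg; have D := dy_der k.
elim: Gg n b eqm => {m g}.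
- move=> m n b _; exists 0; first exact: Xu0.
  by rewrite scaler0 iter_derivation0.
- move=> n b /eqP; rewrite addn_eq0 => /andP[/eqP-> /eqP->].
  by exists 1; [exact: Xu1 | rewrite scale1r].
- move=> m c f g _ IHf _ IHg n b eqm.
  have [f1 Gf1 f1P] := IHf _ _ eqm; have [g1 Gg1 g1P] := IHg _ _ eqm.
  exists (c *: f1 + g1); first exact: XuL.
  rewrite iter_derivationD // iter_derivationZ // f1P g1P scalerDr.
  by rewrite !scalerA mulrC.
- move=> m i f ik Gf IHf n [|b] eqm.
    exists (xvar i * f); last by rewrite scale1r.
    by rewrite -[n]addn0 eqm; apply: xu_spanS; exact: XuX.
  have [|f1 Gf1 f1P] := IHf n b; first by lia.
  exists (udet i k * f1); first exact: XuU.
  have ki : i != k by rewrite eq_sym ord_gt_neq.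
  rewrite iter_dy_udetM // iterS f1P (derivationZ _ _ D).
  have [_ ->] := xu_span_in_first Gf (leqnn k).
  by rewrite scaler0 mulr0 add0r -scalerAr scalerA -natrM -factS.
- move=> m i j f ij jk _ IHf n b eqm.
  have [f1 Gf1 f1P] := IHf _ _ eqm.
  exists (udet i j * f1); first by apply: XuU => //; exact: ltnW.
  rewrite iter_derivation_const // ?f1P ?scalerAr // dy_udet //.
    by rewrite ord_gt_neq // (ltn_trans ij).
  by rewrite ord_gt_neq.
Qed.

Lemma iter_dx_exp k n : iter n (dx k) (xvar k ^+ n) = n`!%:R.
Proof.
have D := dx_der k.
have dX m : dx k (xvar k ^+ m.+1) = m.+1%:R *: xvar k ^+ m.
  elim: m => [|m IHm]; first by rewrite expr1 dx_x eqxx scale1r.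
  rewrite exprS (derivationM _ _ D) IHm dx_x eqxx mul1r !scaler_nat.
  by rewrite -[m.+2]add1n mulrnDr mulr1n exprS mulrnAr.
elim: n => // n IHn; rewrite iterSr dX iter_derivationZ // IHn.
by rewrite scaler_nat -mulrnA mulnC -factS.
Qed.

Lemma in_first0 f : in_first 0 f -> exists c, f = c%:MP.
Proof.
move=> f0; exists f@_0%MM; apply/mpolyP => m; rewrite mcoeffC.
have [->|m0] := eqVneq; first by rewrite mulr1.
rewrite mulr0.
have [k mk] : exists k, (0 < m k)%N.
  apply/existsP; apply: contraNT m0; rewrite negb_exists => /forallP m0.
  by apply/eqP/mnmP=> k; rewrite mnm0E; have := m0 k; lia.
have : f^`M(k) = 0.
  by case: (split_ordP k) => i ->; [case: (f0 i isT) | case: (f0 i isT)].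
move/(congr1 (mcoeff (m - U_(k))%MM)); rewrite mcoeff0 mcoeff_deriv submK.
  by move/eqP; rewrite -mulr_natr mulf_eq0 natrK_eq0 orbF => /eqP.
by rewrite lep1mP -lt0n.
Qed.

Lemma in_firstB k f g : in_first k f -> in_first k g -> in_first k (f - g).
Proof.
move=> f0 g0 i ki; have [[fx fy] [gx gy]] := (f0 i ki, g0 i ki).
by rewrite (derivationB _ _ (dx_der i)) (derivationB _ _ (dy_der i))
           fx fy gx gy subr0.
Qed.

Lemma in_first_iter_dx k l n f : in_first k f -> in_first k (iter n (dx l) f).
Proof.
move=> f0 i ki; have [fx fy] := f0 i ki.
elim: n => //= n [IHx IHy].
rewrite [dx i _]mderiv_comm [dy i _]mderiv_comm.
rewrite [_^`M(lshift d i)]IHx [_^`M(rshift d i)]IHy.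
by split; exact: derivation0 (dx_der l).
Qed.

Lemma in_first_iter_dy k l n f : in_first k f -> in_first k (iter n (dy l) f).
Proof.
move=> f0 i ki; have [fx fy] := f0 i ki.
elim: n => //= n [IHx IHy].
rewrite [dx i _]mderiv_comm [dy i _]mderiv_comm.
rewrite [_^`M(lshift d i)]IHx [_^`M(rshift d i)]IHy.
by split; exact: derivation0 (dy_der l).
Qed.

(** * Constants having a weight *)

Lemma E_leading_part k a b f : E f = 0 -> iter b.+1 (dy k) f = 0 ->
  E (iter a (dx k) (iter b (dy k) f)) = 0.
Proof.
move=> Ef fb; have Efb := E_iter_dy k b Ef.
case: a => [|a]; first exact: Efb.
rewrite E_iter_dx // -[dy k (iter _ _ _)]/(iter b.+1 _ _) fb.
by rewrite (iter_derivation0 _ (dx_der k)) scaler0.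
Qed.

(** The derivative [h] of [f] of order [a + b] in [x_k] has weight [n - a - b],
    is killed by [E^(b+1)] but not by [E^b]; the injectivity of powers of [E] on
    negative weights gives [n - a - b >= - b]. *)
Lemma leading_x_degree_le k a b (n : nat) f : E f = 0 -> has_weight n f ->
  iter b.+1 (dy k) f = 0 -> iter a (dx k) (iter b (dy k) f) != 0 -> (a <= n)%N.
Proof.
move=> Ef Hf fb g0; rewrite leqNgt; apply: contraNN g0 => na.
have [c c0 cP] := iterE_iter_dx k b a Ef.
have Hh : has_weight (n%:Z - (a + b)%N%:Z) (iter (a + b) (dx k) f).
  exact: has_weight_dx.
have h0 : iter (a + b) (dx k) f = 0.
  apply: (raising_inj_neg_weight (m := b.+1) Hh); first by lia.
  rewrite iterS cP (derivationZ _ _ E_der).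
  by rewrite E_leading_part // scaler0.
move: cP; rewrite h0 (iter_derivation0 _ E_der) => /esym/eqP.
by rewrite scaler_eq0 (negPf c0).
Qed.

(** Nested inductions on the degree [b] in [y_k] and, for fixed [b], on the
    degree [a] in [x_k] of the top coefficient: the lifted leading part is
    subtracted until nothing is left. *)
Lemma xu_span_step (k : 'I_d) :
  (forall (n : nat) f, in_first k f -> E f = 0 -> has_weight n f ->
    xu_span k n f) ->
  forall (n : nat) f, in_first k.+1 f -> E f = 0 -> has_weight n f ->
    xu_span k.+1 n f.
Proof.
move=> IHk n f; have [b] := dy_nilpotent k f.
elim: b f => [|b IHb] f; first by move=> /= -> *; exact: Xu0.
have [a] := dx_nilpotent k (iter b (dy k) f).
elim: a f => [|a IHa] f fa fb fk Ef Hf; first exact: IHb.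
(* [g] is [a`! b`!] times the leading coefficient. *)
set g := iter a (dx k) (iter b (dy k) f).
have [/IHa|g0] := eqVneq g 0; first exact.
have an : (a <= n)%N := leading_x_degree_le Ef Hf fb g0.
have gk : in_first k g.
  move=> i; rewrite leq_eqVlt => /orP[/eqP/val_inj <-|ki].
    split; first exact: fa.
    rewrite -[dy k g]/(iter 1 (dy k) g) /g -iter_dx_dy /=.
    rewrite -[dy k (iter _ _ _)]/(iter b.+1 _ _) fb.
    exact: iter_derivation0 (dx_der k).
  exact: (in_first_iter_dx _ _ (in_first_iter_dy _ _ fk)).
have Hg : has_weight (n - a + b)%N g.
  have -> : (n - a + b)%N = (n%:Z + b%:Z - a%:Z) :> int by lia.
  exact/has_weight_dx/has_weight_dy.
have [f1 Gf1 f1P] := xu_span_lift (IHk _ _ gk (E_leading_part a Ef fb) Hg).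
have Gf2 : xu_span k.+1 n (xvar k ^+ a * f1).
  by rewrite -(subnK an); apply: xu_span_exp.
set f2 := _ * f1 in Gf2; pose c : K := (a`! * b`!)%:R^-1.
have Dx := dx_der k; have Dy := dy_der k.
have dyx : dy k (xvar k ^+ a) = 0.
  by apply: derivationX_eq0 => //; exact: dy_x.
have f2P : iter b (dy k) f2 = b`!%:R *: (g * xvar k ^+ a).
  by rewrite iter_derivation_const // f1P -scalerAr mulrC.
have [gx gy] := gk k (leqnn k).
have f2P' : iter a (dx k) (iter b (dy k) f2) = c^-1 *: g.
  rewrite f2P iter_derivationZ // iter_derivation_const // iter_dx_exp.
  by rewrite invrK mulr_natr -scaler_nat scalerA -natrM mulnC.
have c0 : c != 0.
  by rewrite invr_eq0 natrK_eq0 -lt0n muln_gt0 !fact_gt0.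
rewrite -[f](subrK (c *: f2)) addrC; apply: XuL => //.
apply: IHa.
- rewrite !iter_derivationB // !iter_derivationZ // f2P'.
  by rewrite scalerA mulfV // scale1r subrr.
- rewrite iter_derivationB // fb sub0r iter_derivationZ // iterS f2P.
  rewrite (derivationZ _ _ Dy) (derivationM _ _ Dy) gy dyx mul0r mulr0 addr0.
  by rewrite !scaler0 oppr0.
- apply: in_firstB => //; rewrite -[c *: _]addr0.
  exact: (xu_span_in_first (XuL c Gf2 (Xu0 _ _))).
- by rewrite (derivationB _ _ E_der) Ef (derivationZ _ _ E_der)
    (xu_span_E Gf2) scaler0 subr0.
- by apply: has_weightB => //; apply/has_weightZ/(xu_span_weight Gf2).
Qed.

Lemma constants_of_weight (n : nat) f :
  E f = 0 -> has_weight n f -> xu_span d n f.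
Proof.
move=> Ef Hf.
suff main k : (k <= d)%N -> forall (n : nat) f, in_first k f -> E f = 0 ->
    has_weight n f -> xu_span k n f.
  by apply: (main d) => // i; rewrite leqNgt ltn_ord.
elim: k => {n f Ef Hf} [_ n f f0 _|k IHk kd].
  have [c ->] := in_first0 f0; rewrite -alg_mpolyC /has_weight.
  rewrite (derivationZ _ _ H_der) (derivation1 H_der) scaler0 => /esym/eqP.
  rewrite !scaler_eq0 oner_eq0 orbF intrK_eq0 => /orP[/eqP[->]|/eqP->].
    by rewrite -[_%:A]addr0; apply: XuL; [exact: Xu1 | exact: Xu0].
  by rewrite scale0r; exact: Xu0.
exact: (xu_span_step (k := Ordinal kd) (IHk (ltnW kd))).
Qed.

Lemma xu_span_generated k n f :
  xu_span k n f -> generated_subalgebra (@xu_generators K d) f.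
Proof.
have [S1 SL SM] := generated_subalgebra_is_subalgebra (@xu_generators K d).
have S0 : generated_subalgebra (@xu_generators K d) 0.
  by have := SL (-1) 1 1 S1 S1; rewrite scaleN1r addNr.
elim=> {n f} [//|//|n c f g _ Sf _ Sg|n i f _ _ Sf|n i j f ij _ _ Sf].
- exact: SL.
- by apply: SM => // B _; apply; left; exists i.
- by apply: SM => // B _; apply; right; exists i, j.
Qed.

(** * Reduction to constants having a weight *)

(** The operator [\prod_(w <- s) (H - w)].  Every polynomial is killed by such
    a product with distinct [w], which expresses that it is a sum of vectors
    having a weight without naming the summands. *)
Fixpoint kill_weights (s : seq int) f : KXY :=
  if s is w :: s' then kill_weights s' (H f - w%:~R *: f) else f.

Lemma kill_weightsL s c f g :
  kill_weights s (c *: f + g) = c *: kill_weights s f + kill_weights s g.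
Proof.
elim: s f g => //= w s IHs f g; rewrite -IHs; congr kill_weights.
rewrite (derivationD _ _ H_der) (derivationZ _ _ H_der) scalerDr opprD addrACA.
by rewrite scalerBr !scalerA mulrC.
Qed.

Lemma kill_weights0 s : kill_weights s 0 = 0.
Proof.
by have := kill_weightsL s (-1) 0 0; rewrite scaler0 addr0 scaleN1r addNr.
Qed.

Lemma kill_weights_mem s w f :
  w \in s -> has_weight w f -> kill_weights s f = 0.
Proof.
rewrite /has_weight => ws Hf; elim: s ws => //= v s IHs.
rewrite inE => /orP[/eqP <-|/IHs fs]; first by rewrite Hf subrr kill_weights0.
by rewrite Hf -scalerBl -[X in kill_weights s X]addr0 kill_weightsL
  fs kill_weights0 scaler0 addr0.
Qed.

Lemma monomial_weight m : exists w, has_weight w ('X_[m] : KXY).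
Proof.
rewrite mpolyXE_id; apply: (big_ind (fun f => exists w, has_weight w f)).
- by exists 0; exact: has_weight1.
- by move=> f g [v Hf] [w Hg]; exists (v + w); exact: has_weightM.
move=> k _; have [w Hk] : exists w, has_weight w ('X_k : KXY).
  case: (split_ordP k) => i ->.
    by exists 1; exact: has_weight_x.
  by exists (-1); exact: has_weight_y.
elim: (m k) => [|n [v IHn]]; first by exists 0; exact: has_weight1.
by exists (w + v); rewrite exprS; exact: has_weightM.
Qed.

Lemma kill_weights_exists f : exists2 s, uniq s & kill_weights s f = 0.
Proof.
elim/mpolyind: f => [|c m p _ _ [s us ps]]; first by exists [::].
have [w Hm] := monomial_weight m.
have [ws|ws] := boolP (w \in s).
  exists s => //.
  by rewrite kill_weightsL ps (kill_weights_mem ws) // scaler0 addr0.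
exists (w :: s); first by rewrite /= ws.
have kill_p t g : kill_weights t g = 0 -> kill_weights t (H g) = 0.
  elim: t g => [|v t IHt] g /=; first by move=> ->; exact: derivation0 H_der.
  by move/IHt; rewrite (derivationB _ _ H_der) (derivationZ _ _ H_der).
rewrite kill_weightsL (kill_weights_mem _ Hm) ?mem_head // scaler0 add0r /=.
by rewrite -scaleNr addrC kill_weightsL ps scaler0 add0r kill_p.
Qed.

(** Induction on the number of weights: when [(H - w)(H - v) ...] kills [f],
    both [(H - w) f] and [(H - v) f] are constants, as [H E = E H + 2 E], and
    are killed by one factor less; [f] is their difference divided by [v - w].
    A single weight must be nonnegative if [f] is nonzero, since [E] is
    injective on negative weights. *)
Lemma constants_generated f :
  E f = 0 -> generated_subalgebra (@xu_generators K d) f.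
Proof.
have [S1 SL SM] := generated_subalgebra_is_subalgebra (@xu_generators K d).
have S0 : generated_subalgebra (@xu_generators K d) 0.
  by have := SL (-1) 1 1 S1 S1; rewrite scaleN1r addNr.
have [s] := kill_weights_exists f.
have [n] := ubnP (size s); elim: n s f => // n IHn [|w s] f.
  by move=> _ _ /= ->.
rewrite ltnS => sn; case: s sn => [|v s] sn.
  move=> _ /eqP; rewrite subr_eq0 => /eqP Hf Ef.
  have [w0|w0] := boolP (0 <= w); last first.
    by rewrite (@raising_inj_neg_weight 1 w f) //; lia.
  apply: (@xu_span_generated d `|w|%N).
  by apply: constants_of_weight => //; rewrite /has_weight gez0_abs.
move=> /andP[]; rewrite inE negb_or => /andP[wv ws] us' kf Ef.
have /andP[_ us] := us'.
have EHw u : E (H f - u%:~R *: f) = 0.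
  have := HE_comm f; rewrite Ef (derivation0 H_der) scaler0 addr0 => /esym EH.
  rewrite (derivationB _ _ E_der) (derivationZ _ _ E_der) EH Ef.
  by rewrite scaler0 subr0.
have Sw : generated_subalgebra (@xu_generators K d) (H f - w%:~R *: f).
  by apply: (IHn (v :: s)).
have Sv : generated_subalgebra (@xu_generators K d) (H f - v%:~R *: f).
  apply: (IHn (w :: s)) => //; first by rewrite /= ws.
  rewrite -[RHS]kf /=; congr kill_weights.
  rewrite !(derivationB _ _ H_der) !(derivationZ _ _ H_der) !scalerBr !scalerA.
  by rewrite !opprB mulrC addrACA [RHS]addrACA; congr (_ + _); rewrite addrC.
have wvK : (v - w)%:~R != 0 :> K by rewrite intrK_eq0 subr_eq0 eq_sym.
have -> : f = (v - w)%:~R^-1 *: (H f - w%:~R *: f)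
              + ((- (v - w)%:~R^-1) *: (H f - v%:~R *: f) + 0).
  rewrite addr0 scaleNr -scalerBr opprB [X in _ *: X]addrC addrA subrK.
  by rewrite -scalerBl -rmorphB scalerA mulVf // scale1r.
exact: SL Sw (SL _ _ _ Sv S0).
Qed.

End Nowicki.

Theorem theorem3p1 (K : fieldType) (K_char0 : [pchar K] =i pred0)
    (d : nat) (d_ge1 : (1 <= d)%N)
    (delta : {mpoly K[d + d]} -> {mpoly K[d + d]})
    (delta_derivation : is_derivation delta)
    (delta_x : forall i : 'I_d, delta (xvar i) = 0)
    (delta_y : forall i : 'I_d, delta (yvar i) = xvar i) :
  forall f : {mpoly K[d + d]},
    constants delta f <-> generated_subalgebra (@xu_generators K d) f.
Proof.
have deltaE : delta =1 @raising K d.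
  apply: derivation_xy_unique (E_der K d) _ _ => // i.
    by rewrite E_x.
  by rewrite E_y.
move=> f; split=> [f0|]; first by apply: constants_generated; rewrite -?deltaE.
apply; last first.
  by move=> s [[i ->]|[i [j [_ ->]]]]; rewrite /constants deltaE ?E_x ?E_udet.
split=> [|c g h g0 h0|g h g0 h0]; rewrite /constants.
- exact: derivation1.
- by rewrite derivationD // derivationZ // g0 h0 scaler0 addr0.
- by rewrite derivationM // g0 h0 mul0r mulr0 addr0.
Qed.
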